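(* Let $t\ge1$ and let $G,H$ be graphs on at most $n$ vertices. Then $G\equiv_{\mathcal{L}_t}H$ if and only if $G\equiv_{(\mathcal{L}_t)_{\le f(n,t)}}H$, where $f(n,t):=2t\cdot 4^{n^{2t}}$.
   Context: A $(t,t)$-bilabelled graph is $(A,\boldsymbol{u},\boldsymbol{v})$ with $A$ a graph and $\boldsymbol{u},\boldsymbol{v}\in V(A)^t$ (entries not necessarily distinct). It is atomic if every vertex of $A$ occurs among $u_1,\dots,u_t,v_1,\dots,v_t$. Operations: series composition $(K,\boldsymbol{u},\boldsymbol{v})\cdot(K',\boldsymbol{u}',\boldsymbol{v}')$ is the disjoint union of $K,K'$ with $v_i$ identified with $u'_i$ for all $i$, with in-labels $\boldsymbol{u}$ and out-labels $\boldsymbol{v}'$; parallel composition (gluing) $\odot$ is the disjoint union with $u_i$ merged with $u'_i$ and $v_i$ merged with $v'_i$ for all $i$; for $\sigma$ in the symmetric group $\mathfrak{S}_{2t}$, $(F,\boldsymbol{u},\boldsymbol{v})^\sigma:=(F,\boldsymbol{x},\boldsymbol{y})$ where $x_i=(\boldsymbol{uv})_{\sigma(i)}$ and $y_{j-t}=(\boldsymbol{uv})_{\sigma(j)}$ for $1\le i\le t<j\le 2t$ (here $\boldsymbol{uv}$ is the concatenated $2t$-tuple). $\mathcal{L}_t$ is the smallest class of $(t,t)$-bilabelled graphs containing all atomic ones and closed under series composition, gluing with atomic graphs, and permutations of labels by $\sigma\in\mathfrak{S}_{2t}$. For a bilabelled graph $\boldsymbol{L}=(L,\boldsymbol{u},\boldsymbol{v})$,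 $\operatorname{soe}\boldsymbol{L}:=L$. $G\equiv_{\mathcal{L}_t}H$ means $\hom(\operatorname{soe}\boldsymbol{L},G)=\hom(\operatorname{soe}\boldsymbol{L},H)$ for all $\boldsymbol{L}\in\mathcal{L}_t$, and $(\mathcal{L}_t)_{\le N}$ is the set of $\boldsymbol{L}\in\mathcal{L}_t$ whose underlying graph has at most $N$ vertices; $\hom$ counts homomorphisms. *)

(* Defs.v *)
From mathcomp Require Import all_boot perm.

Set Implicit Arguments.
Unset Strict Implicit.
Unset Printing Implicit Defensive.

Local Open Scope quotient_scope.

(* Finite undirected graphs without multiple edges.  Loops are allowed, since
   identifying vertices may create them. *)
Record graph := Graph {
  vertex :> finType;
  edge : rel vertex;
  edge_sym : symmetric edge
}.
Arguments edge {g} _ _.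

Definition is_hom (F G : graph) (h : {ffun F -> G}) : bool :=
  [forall x : F, forall y : F, edge x y ==> edge (h x) (h y)].

Definition hom (F G : graph) : nat := #|[set h : {ffun F -> G} | is_hom h]|.

Definition dunion_edge (K K' : graph) : rel (K + K')%type :=
  fun p q => match p, q with
             | inl x, inl y => edge x y
             | inr x, inr y => edge x y
             | _, _ => false
             end.

Lemma dunion_edge_sym (K K' : graph) : symmetric (@dunion_edge K K').
Proof. by move=> [x|x] [y|y] //=; rewrite edge_sym. Qed.

Definition dunion (K K' : graph) : graph := Graph (@dunion_edge_sym K K').

(* The equivalence relation generated by r. *)
Definition gen_equiv (T : finType) (r : rel T) : rel T :=
  connect (fun x y => r x y || r y x).

Lemma gen_equiv_refl (T : finType) (r : rel T) : reflexive (gen_equiv r).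
Proof. by move=> x; apply: connect0. Qed.

Lemma gen_equiv_sym (T : finType) (r : rel T) : symmetric (gen_equiv r).
Proof. by apply: sym_connect_sym => x y; rewrite orbC. Qed.

Lemma gen_equiv_trans (T : finType) (r : rel T) : transitive (gen_equiv r).
Proof. exact: connect_trans. Qed.

Canonical gen_equiv_equiv (T : finType) (r : rel T) : equiv_rel T :=
  EquivRel (gen_equiv r) (gen_equiv_refl r) (gen_equiv_sym r)
           (@gen_equiv_trans T r).

(* The vertices of T after identifying x with y whenever r x y. *)
Definition merge_vertex (T : finType) (r : rel T) : finType :=
  quot_type {eq_quot (gen_equiv_equiv r)}.

Definition merge_pi (T : finType) (r : rel T) (x : T) : merge_vertex r :=
  \pi_({eq_quot (gen_equiv_equiv r)}) x.

Definition merge_edge (K : graph) (r : rel K) : rel (merge_vertex r) :=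
  fun a b => [exists x : K, exists y : K,
    [&& merge_pi r x == a, merge_pi r y == b & edge x y]].

Lemma merge_edge_sym (K : graph) (r : rel K) : symmetric (@merge_edge K r).
Proof.
move=> a b; apply/idP/idP => /existsP[x /existsP[y /and3P[xa yb xy]]];
by apply/existsP; exists y; apply/existsP; exists x; rewrite xa yb edge_sym.
Qed.

Definition merge (K : graph) (r : rel K) : graph := Graph (@merge_edge_sym K r).

Record bilabelled (t : nat) := Bilabelled {
  soe : graph;
  in_labels : t.-tuple soe;
  out_labels : t.-tuple soe
}.

Definition bilabelled_iso (t : nat) (K K' : bilabelled t) : Prop :=
  exists f : soe K -> soe K',
    [/\ bijective f,
        forall x y, edge (f x) (f y) = edge x y,
        map_tuple f (in_labels K) = in_labels K'
      & map_tuple f (out_labels K) = out_labels K'].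

Definition atomic (t : nat) (K : bilabelled t) : Prop :=
  forall x : soe K, x \in in_labels K \/ x \in out_labels K.

Definition series_rel (t : nat) (K K' : bilabelled t) :
    rel (dunion (soe K) (soe K')) :=
  fun p q => [exists i : 'I_t,
    (p == inl (tnth (out_labels K) i)) && (q == inr (tnth (in_labels K') i))].

Definition series (t : nat) (K K' : bilabelled t) : bilabelled t :=
  @Bilabelled t (merge (@series_rel t K K'))
    [tuple merge_pi (@series_rel t K K') (inl (tnth (in_labels K) i)) | i < t]
    [tuple merge_pi (@series_rel t K K') (inr (tnth (out_labels K') i)) | i < t].

Definition parallel_rel (t : nat) (K K' : bilabelled t) :
    rel (dunion (soe K) (soe K')) :=
  fun p q => [exists i : 'I_t,
    (p == inl (tnth (in_labels K) i)) && (q == inr (tnth (in_labels K') i))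
    || (p == inl (tnth (out_labels K) i))
       && (q == inr (tnth (out_labels K') i))].

Definition parallel (t : nat) (K K' : bilabelled t) : bilabelled t :=
  @Bilabelled t (merge (@parallel_rel t K K'))
    [tuple merge_pi (@parallel_rel t K K') (inl (tnth (in_labels K) i)) | i < t]
    [tuple merge_pi (@parallel_rel t K K') (inl (tnth (out_labels K) i)) | i < t].

Definition permute_labels (t : nat) (s : 'S_(t + t)) (K : bilabelled t) :
    bilabelled t :=
  let uv := cat_tuple (in_labels K) (out_labels K) in
  @Bilabelled t (soe K)
    [tuple tnth uv (s (lshift t i)) | i < t]
    [tuple tnth uv (s (rshift t j)) | j < t].

(* The operations are only defined up to isomorphism, hence L_iso. *)
Inductive L (t : nat) : bilabelled t -> Prop :=
| L_atomic K : atomic K -> L K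
| L_series K K' : L K -> L K' -> L (series K K')
| L_parallel K A : L K -> atomic A -> L (parallel K A)
| L_permute s K : L K -> L (permute_labels s K)
| L_iso K K' : L K -> bilabelled_iso K K' -> L K'.

Definition L_le (t N : nat) (K : bilabelled t) : Prop :=
  L K /\ #|soe K| <= N.

Definition hom_indist (t : nat) (C : bilabelled t -> Prop) (G H : graph) :
    Prop :=
  forall K : bilabelled t, C K -> hom (soe K) G = hom (soe K) H.

Definition vertex_bound (n t : nat) : nat := 2 * t * 4 ^ (n ^ (2 * t)).

(* Main.v *)
(** Counting homomorphisms to G and to H with prescribed values on the labels
    assigns to K a vector of dimension |G|^(2t) + |H|^(2t).  Series composition,
    gluing and label permutation act on these vectors by bilinear, resp. linear,
    maps, so the span S_k of the vectors of graphs of depth at most k stabilises: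
    once S_k = S_(k+1), it contains the vectors of all of L_t.  For dimension
    reasons this occurs for some k <= 2 n^(2t), and a graph of depth k has at
    most 2t 2^k vertices.  The equation hom(K, G) = hom(K, H) is the vanishing of
    a linear functional, hence passes from the graphs of depth k to L_t. *)

Require Import Defs.
From mathcomp Require Import all_boot all_algebra perm.
(* Undoes the shadowing of merge and hom by the previous line. *)
Import Defs.

Set Implicit Arguments.
Unset Strict Implicit.
Unset Printing Implicit Defensive.

Local Open Scope group_scope.
Local Open Scope nat_scope.

(** * Homomorphisms and quotients of vertex sets *)

Lemma is_homP (F G : graph) (h : {ffun F -> G}) :
  reflect (forall x y, edge x y -> edge (h x) (h y)) (is_hom h).
Proof.
apply: (iffP forallP) => [hom_h x y xy | hom_h x].
  exact: implyP (forallP (hom_h x) y) xy.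
by apply/forallP => y; apply/implyP; apply: hom_h.
Qed.

Lemma merge_pi_repr (T : finType) (r : rel T) (a : merge_vertex r) :
  merge_pi r (repr a) = a.
Proof. exact: reprK. Qed.

Lemma merge_pi_eq (T : finType) (r : rel T) x y :
  r x y -> merge_pi r x = merge_pi r y.
Proof.
by move=> rxy; apply/eqmodP; apply: connect1; rewrite rxy.
Qed.

(** Universal property of the quotient: [f] is constant along every path of [r]-steps taken in
    either direction, so its value at the chosen representative is its value on the whole class. *)
Lemma merge_pi_lift (T : finType) (r : rel T) (S : Type) (f : T -> S) x :
  (forall y z, r y z -> f y = f z) -> f (repr (merge_pi r x)) = f x.
Proof.
move=> fr; have : gen_equiv r (repr (merge_pi r x)) x.
  by apply/eqmodP; apply: merge_pi_repr.
case/connectP => p; elim: p (repr _) => [|z p IHp] y /= => [_ -> //|].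
by case/andP=> /orP[/fr-> | /fr<-]; apply: IHp.
Qed.

Lemma card_merge_vertex (T : finType) (r : rel T) : #|merge_vertex r| <= #|T|.
Proof. exact: leq_card (can_inj (@merge_pi_repr T r)). Qed.

(** * Homomorphisms out of a glued disjoint union *)

Section GluedHoms.

Variables (K K' G : graph) (r : rel (dunion K K')).

Definition case_hom (p : {ffun K -> G} * {ffun K' -> G})
    (x : dunion K K') : G :=
  match x with inl a => p.1 a | inr b => p.2 b end.

Definition restrict_hom (h : {ffun merge r -> G}) :
    {ffun K -> G} * {ffun K' -> G} :=
  ([ffun x => h (merge_pi r (inl x))], [ffun x => h (merge_pi r (inr x))]).

Lemma restrict_homE (h : {ffun merge r -> G}) x :
  h (merge_pi r x) = case_hom (restrict_hom h) x.
Proof. by case: x => x /=; rewrite ffunE. Qed.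

Lemma restrict_hom_inj : injective restrict_hom.
Proof.
move=> h h' eq_h; apply/ffunP => a.
by rewrite -(merge_pi_repr a) !restrict_homE eq_h.
Qed.

(** Restriction to the two sides is a bijection from homomorphisms of the glued graph onto pairs of
    homomorphisms that agree on identified vertices. The predicate [Q] carries the conditions on
    label values, so that series composition and gluing both follow from this one count. *)
Lemma card_hom_merge (Q : pred ({ffun K -> G} * {ffun K' -> G})) :
  #|[set h : {ffun merge r -> G} | is_hom h && Q (restrict_hom h)]| =
  #|[set p | [&& is_hom p.1, is_hom p.2, Q p &
      [forall x, forall y, r x y ==> (case_hom p x == case_hom p y)]]]|.
Proof.
rewrite -(card_imset _ restrict_hom_inj); apply: eq_card => p.
rewrite inE; apply/imsetP/and4P => [[h] | [hom1 hom2 Qp /forallP eq_p]].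
  rewrite inE => /andP[/is_homP hom_h Qh ->]; split=> //.
  - apply/is_homP => x y xy; rewrite !ffunE; apply: hom_h.
    apply/existsP; exists (inl x); apply/existsP; exists (inl y).
    by rewrite !eqxx.
  - apply/is_homP => x y xy; rewrite !ffunE; apply: hom_h.
    apply/existsP; exists (inr x); apply/existsP; exists (inr y).
    by rewrite !eqxx.
  apply/forallP => x; apply/forallP => y; apply/implyP => rxy.
  by rewrite -!restrict_homE (merge_pi_eq rxy).
have eq_r x y : r x y -> case_hom p x = case_hom p y.
  by move=> rxy; apply/eqP; apply: (implyP (forallP (eq_p x) y)).
(* The inverse of restriction: evaluate the pair at a representative of each class, which is
   independent of the choice by [eq_r]. *)
pose h : {ffun merge r -> G} :=
  [ffun a : merge r => case_hom p (repr (a : merge_vertex r))].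
have hE x : h (merge_pi r x) = case_hom p x.
  by rewrite ffunE (merge_pi_lift _ eq_r).
have res_h : restrict_hom h = p.
  by case: p {eq_p Qp hom1 hom2 eq_r} @h hE => p1 p2 h hE; congr (_, _);
     apply/ffunP => x; rewrite ffunE hE.
exists h; rewrite // inE res_h Qp andbT; apply/is_homP => a b.
case/existsP=> x /existsP[y /and3P[/eqP<- /eqP<-]]; rewrite !hE.
by case: x y => x [] y //=; apply: is_homP.
Qed.

End GluedHoms.

(** * Homomorphism counts with prescribed label values *)

Definition labelled_homs t (K : bilabelled t) (G : graph)
    (x : t.-tuple G * t.-tuple G) : {set {ffun soe K -> G}} :=
  [set h | [&& is_hom h, map_tuple h (in_labels K) == x.1
             & map_tuple h (out_labels K) == x.2]].

Lemma in_labelled_homs t (K : bilabelled t) (G : graph) x h :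
  (h \in @labelled_homs t K G x) =
  is_hom h && ((map_tuple h (in_labels K), map_tuple h (out_labels K)) == x).
Proof. by rewrite inE -xpair_eqE -surjective_pairing. Qed.

Definition label_hom t (K : bilabelled t) (G : graph) x :=
  #|@labelled_homs t K G x|.
Arguments label_hom {t} K G x.

Lemma hom_label_hom t (K : bilabelled t) (G : graph) :
  hom (soe K) G = \sum_x label_hom K G x.
Proof.
rewrite /hom -sum1_card.
rewrite (partition_big (fun h : {ffun soe K -> G} =>
  (map_tuple h (in_labels K), map_tuple h (out_labels K))) xpredT) //.
apply: eq_bigr => -[x y] _; rewrite /label_hom -sum1_card.
by apply: eq_bigl => h; rewrite !inE xpair_eqE.
Qed.

Lemma map_tuple_eqP (S T R : eqType) n (f : S -> R) (g : T -> R)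
    (u : n.-tuple S) (v : n.-tuple T) :
  reflect (forall i, f (tnth u i) = g (tnth v i))
          (map_tuple f u == map_tuple g v).
Proof.
apply: (iffP eqP) => [/(congr1 (fun w => tnth w _)) eq_fg i | eq_fg].
  by have := eq_fg i; rewrite !tnth_map.
by apply: eq_from_tnth => i; rewrite !tnth_map.
Qed.

(** Series composition is the matrix product, with rows and columns indexed by t-tuples of vertices
    of [G]. *)
Lemma label_hom_series t (K K' : bilabelled t) (G : graph) x y :
  label_hom (series K K') G (x, y) =
  \sum_z label_hom K G (x, z) * label_hom K' G (z, y).
Proof.
pose Q (p : {ffun soe K -> G} * {ffun soe K' -> G}) :=
  (map_tuple p.1 (in_labels K) == x) && (map_tuple p.2 (out_labels K') == y).
transitivity #|[set h : {ffun soe (series K K') -> G} |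
  is_hom h && Q (restrict_hom h)]|.
  apply: eq_card => h; rewrite !inE /Q /=.
  congr (_ && (_ && _)); congr (_ == _);
    by apply: eq_from_tnth => i; rewrite !tnth_map tnth_ord_tuple ffunE.
rewrite card_hom_merge -sum1_card.
(* The pairs are sorted by the tuple z that both maps take on the identified labels; for fixed z the
   two maps can be chosen independently. *)
rewrite (partition_big (fun p : {ffun soe K -> G} * {ffun soe K' -> G} =>
  map_tuple p.1 (out_labels K)) xpredT) //=.
apply: eq_bigr => z _; rewrite /label_hom -cardsX -sum1_card.
apply: eq_bigl => -[h1 h2]; rewrite !inE /= /Q /=.
apply/andP/andP => [[/and4P[-> -> /andP[-> ->]] /forallP eq_h /eqP<-] |].
  rewrite eqxx; split=> //=; rewrite andbT.
  apply/map_tuple_eqP => i; apply/esym/eqP.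
  apply: (implyP (forallP (eq_h (inl (tnth (out_labels K) i)))
                          (inr (tnth (in_labels K') i)))).
  by apply/existsP; exists i; rewrite !eqxx.
case=> /and3P[-> -> /eqP <-] /and3P[-> eq_h ->]; rewrite eqxx; split=> //=.
apply/forallP => a; apply/forallP => b; apply/implyP.
case/existsP=> i /andP[/eqP-> /eqP->] /=.
by rewrite eq_sym in eq_h; rewrite ((map_tuple_eqP _ _ _ _ eq_h) i).
Qed.

(** Gluing is the entrywise product: once the labels of [K] take the values [x], agreement on merged
    vertices forces the same values on those of [K']. *)
Lemma label_hom_parallel t (K K' : bilabelled t) (G : graph) x :
  label_hom (parallel K K') G x = label_hom K G x * label_hom K' G x.
Proof.
pose Q (p : {ffun soe K -> G} * {ffun soe K' -> G}) :=
  (map_tuple p.1 (in_labels K) == x.1) && (map_tuple p.1 (out_labels K) == x.2).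
transitivity #|[set h : {ffun soe (parallel K K') -> G} |
  is_hom h && Q (restrict_hom h)]|.
  apply: eq_card => h; rewrite !inE /Q /=.
  congr (_ && (_ && _)); congr (_ == _);
    by apply: eq_from_tnth => i; rewrite !tnth_map tnth_ord_tuple ffunE.
rewrite card_hom_merge /label_hom -cardsX.
apply: eq_card => -[h1 h2]; rewrite !inE /= /Q /=.
case: x Q => x y _ /=.
apply/and4P/andP => [[-> -> /andP[/eqP<- /eqP<-] /forallP eq_h] |].
  rewrite !eqxx; split=> //=.
  apply/andP; split; apply/map_tuple_eqP => i; apply/esym/eqP.
    apply: (implyP (forallP (eq_h (inl (tnth (in_labels K) i)))
                            (inr (tnth (in_labels K') i)))).
    by apply/existsP; exists i; rewrite !eqxx.
  apply: (implyP (forallP (eq_h (inl (tnth (out_labels K) i)))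
                          (inr (tnth (out_labels K') i)))).
  by apply/existsP; exists i; rewrite !eqxx orbT.
case=> /and3P[-> /eqP <- /eqP <-] /and3P[-> in_h out_h]; rewrite !eqxx.
split=> //=; apply/forallP => a; apply/forallP => b; apply/implyP.
case/existsP=> i /orP[] /andP[/eqP-> /eqP->] /=.
  by rewrite ((map_tuple_eqP _ _ _ _ in_h) i).
by rewrite ((map_tuple_eqP _ _ _ _ out_h) i).
Qed.

(** The type [T] is arbitrary so that the same action applies to label tuples and to their images
    under a homomorphism. *)
Definition permute_pair t (s : 'S_(t + t)) (T : Type)
    (x : t.-tuple T * t.-tuple T) : t.-tuple T * t.-tuple T :=
  ([tuple tnth (cat_tuple x.1 x.2) (s (lshift t i)) | i < t],
   [tuple tnth (cat_tuple x.1 x.2) (s (rshift t i)) | i < t]).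

Lemma tnth_permute_pair t (s : 'S_(t + t)) (T : Type)
    (x : t.-tuple T * t.-tuple T) i :
  tnth (cat_tuple (permute_pair s x).1 (permute_pair s x).2) i =
  tnth (cat_tuple x.1 x.2) (s i).
Proof.
by rewrite -(splitK i); case: (split i) => j;
  rewrite ?tnth_lshift ?tnth_rshift tnth_mktuple.
Qed.

Lemma eq_from_tnth_cat t (T : Type) (x y : t.-tuple T * t.-tuple T) :
  (forall i, tnth (cat_tuple x.1 x.2) i = tnth (cat_tuple y.1 y.2) i) -> x = y.
Proof.
case: x y => [x1 x2] [y1 y2] /= eq_xy; congr (_, _); apply: eq_from_tnth => i.
  by have := eq_xy (lshift t i); rewrite !tnth_lshift.
by have := eq_xy (rshift t i); rewrite !tnth_rshift.
Qed.

Lemma permute_pairK t (s : 'S_(t + t)) (T : Type) :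
  cancel (@permute_pair t s T) (@permute_pair t s^-1 T).
Proof.
by move=> x; apply: eq_from_tnth_cat => i; rewrite !tnth_permute_pair permKV.
Qed.

Lemma permute_pairKV t (s : 'S_(t + t)) (T : Type) :
  cancel (@permute_pair t s^-1 T) (@permute_pair t s T).
Proof. by rewrite -{2}(invgK s); apply: permute_pairK. Qed.

Lemma map_permute_pair t (s : 'S_(t + t)) (T S : Type) (f : T -> S) x :
  permute_pair s (map_tuple f x.1, map_tuple f x.2) =
  (map_tuple f (permute_pair s x).1, map_tuple f (permute_pair s x).2).
Proof.
have map_cat (y : t.-tuple T * t.-tuple T) i :
    tnth (cat_tuple (map_tuple f y.1) (map_tuple f y.2)) i =
    f (tnth (cat_tuple y.1 y.2) i).
  by rewrite -(splitK i); case: (split i) => j;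
    rewrite ?tnth_lshift ?tnth_rshift tnth_map.
apply: eq_from_tnth_cat => i.
by rewrite tnth_permute_pair !map_cat tnth_permute_pair.
Qed.

(** The inverse appears because permuting labels commutes with mapping them: the permuted labels go
    to [x] exactly when the original ones go to its preimage under the action of [s]. *)
Lemma label_hom_permute t (s : 'S_(t + t)) (K : bilabelled t) (G : graph) x :
  label_hom (permute_labels s K) G x = label_hom K G (permute_pair s^-1 x).
Proof.
apply: eq_card => h; rewrite in_labelled_homs /= in_labelled_homs.
congr (_ && _).
rewrite -(map_permute_pair s h (in_labels K, out_labels K)).
by rewrite (can2_eq (@permute_pairK _ _ _) (@permute_pairKV _ _ _)).
Qed.

Lemma label_hom_iso t (K K' : bilabelled t) (G : graph) :
  bilabelled_iso K K' -> label_hom K G =1 label_hom K' G.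
Proof.
case=> f [bij_f edge_f in_f out_f] x.
have [g fK gK] := bij_f.
pose pull (h : {ffun soe K' -> G}) : {ffun soe K -> G} := [ffun a => h (f a)].
have pull_inj : injective pull.
  move=> h h' /ffunP eq_h; apply/ffunP => a.
  by have := eq_h (g a); rewrite !ffunE gK.
rewrite /label_hom -(card_imset _ pull_inj); apply: eq_card => h.
apply/idP/imsetP => [|[h' hom_h' ->]]; last first.
  move: hom_h'; rewrite !in_labelled_homs => /andP[/is_homP hom_h' /eqP<-].
  rewrite -in_f -out_f; apply/andP; split.
    by apply/is_homP => a b ab; rewrite !ffunE; apply: hom_h'; rewrite edge_f.
  by apply/eqP; congr (_, _); apply: eq_from_tnth => i; rewrite !tnth_map ffunE.
rewrite in_labelled_homs => /andP[/is_homP hom_h /eqP<-].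
exists [ffun a => h (g a)]; last by apply/ffunP => a; rewrite !ffunE fK.
rewrite in_labelled_homs -in_f -out_f; apply/andP; split.
  apply/is_homP => a b ab; rewrite !ffunE; apply: hom_h.
  by rewrite -edge_f !gK.
by apply/eqP; congr (_, _); apply: eq_from_tnth => i;
  rewrite !tnth_map ffunE fK.
Qed.

(** * Depth of a construction and number of vertices *)

(* Label permutations are free: they do not increase the number of vertices. *)
Inductive L_depth (t : nat) : nat -> bilabelled t -> Prop :=
| L_depth_atomic k K : atomic K -> L_depth k K
| L_depth_series k K K' : L_depth k K -> L_depth k K' ->
    L_depth k.+1 (series K K')
| L_depth_parallel k K A : L_depth k K -> atomic A ->
    L_depth k.+1 (parallel K A)
| L_depth_permute k s K : L_depth k K -> L_depth k (permute_labels s K)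
| L_depth_iso k K K' : L_depth k K -> bilabelled_iso K K' -> L_depth k K'.

Lemma L_depthS t k (K : bilabelled t) : L_depth k K -> L_depth k.+1 K.
Proof.
elim=> {k K} [k K atK | k K K' _ IH _ IH' | k K A _ IH atA | k s K _ IH
  | k K K' _ IH isoK].
- exact: L_depth_atomic.
- exact: L_depth_series.
- exact: L_depth_parallel.
- exact: L_depth_permute.
- exact: L_depth_iso isoK.
Qed.

Lemma L_depth_L t k (K : bilabelled t) : L_depth k K -> L K.
Proof.
elim=> {k K} [k K atK | k K K' _ IH _ IH' | k K A _ IH atA | k s K _ IH
  | k K K' _ IH isoK].
- exact: L_atomic.
- exact: L_series.
- exact: L_parallel.
- exact: L_permute.
- exact: L_iso isoK.
Qed.

Lemma card_atomic t (K : bilabelled t) : atomic K -> #|soe K| <= 2 * t.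
Proof.
move=> atK.
have -> : 2 * t = size (in_labels K ++ out_labels K).
  by rewrite size_cat !size_tuple addnn mul2n.
apply: leq_trans (card_size _); apply/subset_leq_card/subsetP => x _.
by rewrite mem_cat; apply/orP; apply: atK.
Qed.

(** A quotient has no more vertices than the disjoint union, so each level of depth at most doubles
    the bound, starting from 2t for atomic graphs. *)
Lemma card_L_depth t k (K : bilabelled t) :
  L_depth k K -> #|soe K| <= 2 * t * 2 ^ k.
Proof.
have le2 k' : 2 * t <= 2 * t * 2 ^ k' by rewrite leq_pmulr // expn_gt0.
elim=> {k K} [k K /card_atomic leK | k K K' _ IH _ IH' | k K A _ IH atA
  | k s K _ IH | k K K' _ IH [f [/bij_eq_card <- _ _ _]]] //.
- exact: leq_trans leK _.
- apply: leq_trans (card_merge_vertex _) _.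
  by rewrite card_sum expnS mulnCA mul2n -addnn leq_add.
apply: leq_trans (card_merge_vertex _) _.
rewrite card_sum expnS mulnCA mul2n -addnn leq_add //.
exact: leq_trans (card_atomic atA) _.
Qed.

(** * Linear maps on spans, and stabilisation of a chain of spans *)

Section LinearAlgebra.

Local Open Scope ring_scope.
Import GRing.Theory.

Lemma span_linear (F : fieldType) (U V : vectType F) (f : U -> V)
    (s : seq U) (W : {vspace V}) :
  linear f -> {in s, forall u, f u \in W} -> {in <<s>>%VS, forall u, f u \in W}.
Proof.
move=> lin_f sW u /(@coord_span _ _ _ (in_tuple s)) ->.
elim/big_rec: _ => [|i v _ fv].
  (* Here [f] is a bare function; that it fixes zero is obtained from f(0) = -f(0) + f(0). *)
  have := lin_f (-1) 0 0; rewrite scaler0 addr0 scaleN1r addNr => ->.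
  exact: mem0v.
by rewrite lin_f memvD // memvZ // sW // mem_nth.
Qed.

(* Otherwise one could extend a free family by one vector at each step k,
   beyond the dimension of the space. *)
Lemma saturated_span (F : fieldType) (V : vectType F) (A : nat -> V -> Prop)
    (P : bool) :
    (forall k v, A k v -> A k.+1 v) ->
    (forall k s, (k <= dim V)%N -> {in s, forall v, A k v} ->
       (forall v, A k.+1 v -> v \in <<s>>%VS) -> P) ->
  P.
Proof.
move=> AS good.
(* The family at step k has exactly k members, and [m] bounds the number of extensions still
   possible. *)
suff step m k s : (dim V < m + k)%N -> free s -> size s = k ->
    {in s, forall v, A k v} -> P.
  by apply: (step (dim V).+1 0%N [::]); rewrite ?addn0 // nil_free.
elim: m k s => [|m IHm] k s lt_m free_s size_s As.
  move: lt_m; rewrite add0n -size_s -(eqP free_s) ltnNge -dimvf.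
  by rewrite dimvS ?subvf.
have le_k : (k <= dim V)%N.
  by rewrite -size_s -(eqP free_s) -dimvf dimvS ?subvf.
(* Whether some [v] in [A k.+1] escapes the span cannot be decided, [A] being an arbitrary
   predicate. As [P] is boolean, its negation may be assumed; then any escaping [v] would extend [s]
   and yield [P] by induction. *)
apply: contraT => notP; rewrite -(negbTE notP).
apply: (good k s) => // v Av; apply: contraNT notP => sv.
apply: (IHm k.+1 (v :: s)); rewrite ?addnS //= ?free_cons ?sv ?size_s //.
by move=> w; rewrite inE => /predU1P[-> // | /As/AS].
Qed.

End LinearAlgebra.

(** * The vector of counts into both graphs, and the operations on it *)

Section Tensors.

Local Open Scope ring_scope.
Import GRing.Theory.

Variables (t : nat) (G : bool -> graph).

(** Both graphs share one index set, so that a linear combination in this space has the same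
    coefficients for either graph. *)
Definition tensor_index : finType :=
  {b : bool & (t.-tuple (G b) * t.-tuple (G b))%type}.

Local Notation tensor := {ffun tensor_index -> rat^o}.

Definition idx b (x : t.-tuple (G b) * t.-tuple (G b)) : tensor_index :=
  Tagged (fun b => (t.-tuple (G b) * t.-tuple (G b))%type) x.

Definition hom_tensor (K : bilabelled t) : tensor :=
  [ffun p : tensor_index => (label_hom K (G (tag p)) (tagged p))%:R].

Definition mul_tensor (v w : tensor) : tensor :=
  [ffun p : tensor_index => \sum_z v (idx ((tagged p).1, z)) *
                                   w (idx (z, (tagged p).2))].

Definition schur_tensor (v w : tensor) : tensor :=
  [ffun p => (v p : rat) * w p].

Definition permute_tensor (s : 'S_(t + t)) (v : tensor) : tensor :=
  [ffun p : tensor_index => v (idx (permute_pair s^-1%g (tagged p)))].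

Definition sum_diff (v : tensor) : rat^o :=
  \sum_x v (@idx true x) - \sum_x v (@idx false x).

Lemma hom_tensor_series K K' :
  hom_tensor (series K K') = mul_tensor (hom_tensor K) (hom_tensor K').
Proof.
apply/ffunP => -[b [x y]]; rewrite !ffunE label_hom_series natr_sum.
by apply: eq_bigr => z _; rewrite natrM !ffunE.
Qed.

Lemma hom_tensor_parallel K K' :
  hom_tensor (parallel K K') = schur_tensor (hom_tensor K) (hom_tensor K').
Proof. by apply/ffunP => p; rewrite !ffunE label_hom_parallel natrM. Qed.

Lemma hom_tensor_permute s K :
  hom_tensor (permute_labels s K) = permute_tensor s (hom_tensor K).
Proof. by apply/ffunP => p; rewrite !ffunE label_hom_permute. Qed.

Lemma hom_tensor_iso K K' : bilabelled_iso K K' -> hom_tensor K = hom_tensor K'.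
Proof.
by move=> isoK; apply/ffunP => p; rewrite !ffunE (label_hom_iso isoK).
Qed.

(** Summing over all label values recovers the unrestricted counts, and these can be compared in
    [rat] because it has characteristic zero. *)
Lemma sum_diff_hom_tensor K :
  (sum_diff (hom_tensor K) == 0) =
  (hom (soe K) (G true) == hom (soe K) (G false)).
Proof.
rewrite subr_eq0 !hom_label_hom -(Num.Theory.eqr_nat rat) !natr_sum.
by congr (_ == _); apply: eq_bigr => x _; rewrite ffunE.
Qed.

Lemma mul_tensor_linearl w : linear (mul_tensor^~ w).
Proof.
move=> a u v; apply/ffunP => p; rewrite !ffunE scaler_sumr -big_split /=.
apply: eq_bigr => z _; rewrite !ffunE mulrDl; congr (_ + _).
exact/esym/mulrA.
Qed.

Lemma mul_tensor_linearr w : linear (mul_tensor w).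
Proof.
move=> a u v; apply/ffunP => p; rewrite !ffunE scaler_sumr -big_split /=.
by apply: eq_bigr => z _; rewrite !ffunE mulrDr; congr (_ + _); exact: mulrCA.
Qed.

Lemma schur_tensor_linearl w : linear (schur_tensor^~ w).
Proof.
move=> a u v; apply/ffunP => p; rewrite !ffunE mulrDl; congr (_ + _).
exact/esym/mulrA.
Qed.

Lemma permute_tensor_linear s : linear (permute_tensor s).
Proof. by move=> a u v; apply/ffunP => p; rewrite !ffunE. Qed.

Lemma sum_diff_linear : linear sum_diff.
Proof.
move=> a u v; rewrite /sum_diff scalerBr !scaler_sumr addrACA -opprD.
by rewrite -!big_split /=; congr (_ - _); apply: eq_bigr => x _; rewrite !ffunE.
Qed.

Section Saturation.

Variables (k : nat) (s : seq tensor).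
Hypothesis s_depth :
  {in s, forall v, exists2 K, L_depth k K & v = hom_tensor K}.
Hypothesis span_s : forall K, L_depth k.+1 K -> hom_tensor K \in <<s>>%VS.

Lemma L_tensor_span K : L K -> hom_tensor K \in <<s>>%VS.
Proof.
have span_k K' : L_depth k K' -> hom_tensor K' \in <<s>>%VS.
  by move/L_depthS/span_s.
elim=> {K} [K atK | K K' _ IH _ IH' | K A _ IH atA | sg K _ IH
  | K K' _ IH isoK].
- exact/span_k/L_depth_atomic.
- rewrite hom_tensor_series.
  (* Bilinearity is used one argument at a time: each factor is reduced to a generator of depth k,
     and the product of two generators has depth k+1. *)
  apply: (span_linear (mul_tensor_linearl _)) IH => _ /s_depth[C dC ->].
  apply: (span_linear (mul_tensor_linearr _)) IH' => _ /s_depth[C' dC' ->].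
  by rewrite -hom_tensor_series; apply/span_s/L_depth_series.
- rewrite hom_tensor_parallel.
  (* Only the left factor is reduced to generators; the right one stays the given atomic graph, as
     the depth rule for gluing requires. *)
  apply: (span_linear (schur_tensor_linearl _)) IH => _ /s_depth[C dC ->].
  by rewrite -hom_tensor_parallel; apply/span_s/L_depth_parallel.
- rewrite hom_tensor_permute.
  apply: (span_linear (permute_tensor_linear _)) IH => _ /s_depth[C dC ->].
  by rewrite -hom_tensor_permute; apply/span_k/L_depth_permute.
by rewrite -(hom_tensor_iso isoK).
Qed.

End Saturation.

Lemma L_depth_determined :
  (forall k K, (k <= #|tensor_index|)%N -> @L_depth t k K ->
     hom (soe K) (G true) = hom (soe K) (G false)) ->
  hom_indist (@L t) (G true) (G false).
Proof.
move=> eq_hom K LK; apply/eqP.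
pose A k v := exists2 K, @L_depth t k K & v = hom_tensor K.
apply: (@saturated_span rat tensor A) => [k v [C dC ->] | k s le_k As span_s].
  by exists C => //; apply: L_depthS.
rewrite -sum_diff_hom_tensor -memv0.
have Ks : hom_tensor K \in <<s>>%VS.
  by apply: (L_tensor_span As) LK => C dC; apply: span_s; exists C.
(* With the zero subspace as target, vanishing on the generators gives vanishing on the span. *)
apply: (span_linear sum_diff_linear) Ks => _ /As[C dC ->].
rewrite memv0 sum_diff_hom_tensor; apply/eqP/(eq_hom k) => //.
(* The dimension of the function space unfolds to the number of indices times 1, the dimension of
   [rat^o]. *)
by move: le_k; rewrite /dim /= muln1.
Qed.

Lemma card_tensor_index :
  #|tensor_index| = (#|G true| ^ (2 * t) + #|G false| ^ (2 * t))%N.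
Proof.
by rewrite card_tagged sumnE big_map big_enum big_bool /= !card_prod !card_tuple
  -!expnD addnn mul2n.
Qed.

End Tensors.

Theorem theorem32 (t n : nat) (G H : graph) (ht : 1 <= t)
    (hG : #|G| <= n) (hH : #|H| <= n) :
  hom_indist (@L t) G H <-> hom_indist (@L_le t (vertex_bound n t)) G H.
Proof.
split=> [eq_L K [LK _] | eq_L]; first exact: eq_L.
apply: (@L_depth_determined t (fun b => if b then G else H)) => k K le_k dK.
apply: eq_L; split; first exact: L_depth_L dK.
apply: leq_trans (card_L_depth dK) _; rewrite leq_mul2l; apply/orP; right.
(* The base 4 absorbs the factor 2 of the depth bound 2 n^(2t), one n^(2t) coming from each
   graph. *)
rewrite (_ : 4 = 2 ^ 2) // -expnM leq_exp2l //.
apply: leq_trans le_k _; rewrite card_tensor_index (mul2n (n ^ _)) -addnn.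
by rewrite leq_add ?leq_exp2r ?muln_gt0.
Qed.
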